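(* Let $X$ be a finite-dimensional (real) Hilbert space of dimension $d$ and let $T:X\to X$ be nonexpansive. Let $x_0\in X$, $y\in\mathrm{Fix}T$ and let $b\in\mathbb{N}$ with $\|x_0-y\|\leq b$. Let $\lambda:[0,+\infty)\to[0,1]$ be Lebesgue measurable and let $x$ be the unique strong global solution of \[ \dot x(t)=\lambda(t)\left(T(x(t))-x(t)\right),\qquad x(0)=x_0. \] Assume either: (1) $\int_0^{+\infty}\lambda(t)(1-\lambda(t))\,dt=+\infty$ with a divergence modulus $\eta:(0,\infty)\to\mathbb{N}$, i.e. $\int_0^r\lambda(t)(1-\lambda(t))\,dt\geq K$ for all $K>0$ and $r\geq\eta(K)$, where $\eta(K)\geq\eta(L)$ for $K\geq L$; in this case set $\varphi(\varepsilon):=\eta(b^2/\varepsilon^2)$; or (2) $\inf_{t\geq0}\lambda(t)>0$ with a witness $\underline{\lambda}>0$, i.e. $\lambda(t)\geq\underline{\lambda}$ for all $t\geq0$; in this case set $\varphi(\varepsilon):=4b^4/(\underline{\lambda}^2\varepsilon^2)$. Then, in either case, for all $\varepsilon>0$ and $f:\mathbb{N}\to\mathbb{N}$: \[ \exists n\leq\Delta(\varepsilon/4,f)\ \forall s,t\in[n,n+f(n)]\ \left(\|x(s)-x(t)\|\leq\varepsilon\text{ and }\|x(t)-T(x(t))\|\leq\varepsilon\right), \] where for $\delta>0$: $\Delta(\delta,f):=\max\{\Delta(i,\delta,f)\mid i\leq P\}+1$ with $P:=\left\lceil2(\lceil\sqrt{12}\,\delta^{-1}\rceil+1)\sqrt{d}\,b\right\rceil^d+1$,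 $\Delta(0,\delta,f):=0$ and, for $j\geq1$, $\Delta(j,\delta,f):=\varphi(\widehat\delta_j)$ with \[ \widehat\delta_j:=\min\left\{\frac{\delta}{2},\ \frac{\delta^2/12}{4b(f(m+1)+1)}\ \Big|\ m\leq\Delta(i,\delta,f),\ i<j\right\}. \]
   Context: $\mathbb{N}$ denotes the natural numbers; $m,i$ range over natural numbers. $\mathrm{Fix}T$ is the set of fixed points of $T$. A strong global solution is a function $x:[0,+\infty)\to X$ which is absolutely continuous on each interval $[0,a]$, $a\in(0,\infty)$, satisfies $x(0)=x_0$, and satisfies the differential equation almost everywhere on $[0,+\infty)$; under the stated assumptions it exists and is unique. *)

(* Defs.v *)
From HB Require Import structures.
From mathcomp Require Import all_boot all_order all_algebra.
From mathcomp Require Import all_classical all_reals all_analysis.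

Set Implicit Arguments.
Unset Strict Implicit.
Unset Printing Implicit Defensive.

Import Order.TTheory GRing.Theory Num.Theory.
Import numFieldNormedType.Exports.

Local Open Scope classical_set_scope.
Local Open Scope ring_scope.

(* Finite-dimensional Banach spaces; such a space X is a Hilbert space once its
   norm is the one induced by some ip : {dot X for idfun}. *)
#[short(type="finDimBanachType")]
HB.structure Definition FinDimBanach (R : numFieldType) :=
  {V of CompleteNormedModule R V & Vector R V}.

Definition is_inner_product (R : realType) (X : finDimBanachType R)
    (ip : {dot X for idfun}) : Prop :=
  forall u : X, `|u| = Num.sqrt (ip u u).

Definition nonexpansive (R : realType) (X : finDimBanachType R) (T : X -> X) :
  Prop := forall u v : X, `|T u - T v| <= `|u - v|.

Definition Fix (X : Type) (T : X -> X) : set X := [set u | T u = u].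

(* The reals with the sigma-algebra of Lebesgue (rather than Borel) measurable
   sets: the domain of completed_lebesgue_measure. *)
Definition lebesgueTypeR (R : realType) : measurableType _ :=
  caratheodory_type (@wlength R idfun)^*%mu.

Definition lebesgue_measurable_fun (R : realType) (D : set R) (g : R -> R) :
  Prop := measurable_fun (D : set (lebesgueTypeR R)) (g : lebesgueTypeR R -> R).

(* The intervals ]u i, v i[ are pairwise disjoint subintervals of [a, b]; the
   condition on i != j also forbids empty intervals inside another one, which is
   harmless since they do not contribute to either sum. *)
Definition abs_continuous (R : realType) (X : normedModType R) (a b : R)
    (g : R -> X) : Prop :=
  forall e : R, 0 < e -> exists2 c : R, 0 < c &
    forall (n : nat) (u v : 'I_n -> R),
      (forall i, [/\ a <= u i, u i <= v i & v i <= b]) ->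
      (forall i j, i != j -> v i <= u j \/ v j <= u i) ->
      \sum_i (v i - u i) < c ->
      \sum_i `|g (v i) - g (u i)| < e.

(* Functions on [0, +oo[ are represented by functions on R whose values at
   negative reals are irrelevant. The two-sided derivative below is only affected
   by such values at t = 0, i.e. on a null set. *)
Definition strong_global_solution (R : realType) (X : finDimBanachType R)
    (lam : R -> R) (T : X -> X) (x0 : X) (x : R -> X) : Prop :=
  [/\ forall a : R, 0 < a -> abs_continuous 0 a x,
      x 0 = x0
    & {ae @completed_lebesgue_measure R, forall t, 0 <= t ->
        is_derive (t : R) 1 x (lam t *: (T (x t) - x t))}].

Definition divergence_modulus (R : realType) (lam : R -> R) (eta : R -> nat) :
    Prop :=
  (forall K r : R, 0 < K -> (eta K)%:R <= r ->
     (K%:E <= \int[@completed_lebesgue_measure R]_(t in `[0%R, r])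
                (lam t * (1 - lam t))%:E)%E) /\
  (forall K L : R, 0 < L -> L <= K -> (eta L <= eta K)%N).

Section bound.
Context (R : realType) (phi : R -> R) (b : nat) (f : nat -> nat).

(* min {delta / 2, (delta^2 / 12) / (4 b (f(m+1) + 1)) | m <= D i, i < j};
   the naturals m <= D i are among those m <= Num.truncn (D i). *)
Definition delta_hat (delta : R) (D : nat -> R) (j : nat) : R :=
  \big[Num.min/delta / 2]_(i < j)
    \big[Num.min/delta / 2]_(m < (Num.truncn (D i)).+1 | m%:R <= D i)
      ((delta ^+ 2 / 12) / (4 * b%:R * ((f m.+1)%:R + 1))).

(* [:: Delta 0; ...; Delta j], by course-of-values recursion *)
Fixpoint Delta_hist (delta : R) (j : nat) : seq R :=
  if j is j'.+1 then
    let h := Delta_hist delta j' in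
    rcons h (phi (delta_hat delta (nth 0 h) j))
  else [:: 0].

Definition Delta_step (j : nat) (delta : R) : R := nth 0 (Delta_hist delta j) j.

Lemma size_Delta_hist delta j : size (Delta_hist delta j) = j.+1.
Proof. by elim: j => //= j IH; rewrite size_rcons IH. Qed.

Lemma nth_Delta_hist delta i j : (i <= j)%N ->
  nth 0 (Delta_hist delta j) i = Delta_step i delta.
Proof.
elim: j => [|j IH]; first by rewrite leqn0 => /eqP ->.
rewrite leq_eqVlt => /orP[/eqP -> //|]; rewrite ltnS => ij.
by rewrite /= nth_rcons size_Delta_hist ltnS ij IH.
Qed.

Lemma Delta_step0 delta : Delta_step 0 delta = 0.
Proof. by []. Qed.

Lemma Delta_stepE delta j : (0 < j)%N ->
  Delta_step j delta = phi (delta_hat delta (Delta_step ^~ delta) j).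
Proof.
case: j => // j _; rewrite /Delta_step /= nth_rcons size_Delta_hist ltnn eqxx.
congr phi; apply: eq_bigr => i _.
by rewrite nth_Delta_hist // -ltnS ltn_ord.
Qed.

Definition cover_bound (d : nat) (delta : R) : nat :=
  `|Num.ceil (2 * ((Num.ceil (Num.sqrt 12 * delta^-1))%:~R + 1)
              * Num.sqrt d%:R * b%:R : R)|%N ^ d + 1.

(* The maximum may start from 0 because Delta_step 0 delta = 0. *)
Definition Delta (d : nat) (delta : R) : R :=
  \big[Num.max/0]_(i < (cover_bound d delta).+1) Delta_step i delta + 1.

End bound.

(* Main.v *)
Require Import Defs.
From HB Require Import structures.
From mathcomp Require Import all_boot all_order all_algebra.
From mathcomp Require Import all_classical all_reals all_analysis.
From mathcomp Require Import measurable_realfun ring lra.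

Import Order.TTheory GRing.Theory Num.Theory.
Import numFieldNormedType.Exports.

Local Open Scope classical_set_scope.
Local Open Scope ring_scope.

Set Implicit Arguments.
Unset Strict Implicit.
Unset Printing Implicit Defensive.

(** The trajectory [x] moves towards [T (x t)] at speed [lam t <= 1].  Three
    consequences of nonexpansiveness carry the proof; each is an infinitesimal
    statement at points of differentiability, turned into a global one by
    [abs_continuous_growth]: an absolutely continuous real function whose
    increments are a.e. locally at most [K >= 0] per unit of time grows by at most
    [K] per unit of time.

    - The distance from [x t] to any point [p] grows at rate at most
      [resid p = |T p - p|] ([dist_growth]).  A fixed point is never moved away
      from (Fejer monotonicity), and an almost fixed point is moved away from
      only slowly.

    - The residual [resid (x t)] never increases ([resid_nonincreasing]).

    - In the Hilbert case [|x t - y|^2] decreases at rate at least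
      [lam t * resid (x t)^2] for a fixed point [y] ([energy_slope]).  Since
      this energy starts below [b^2] and the residual is nonincreasing,
      [resid (x r)^2 * \int_0^r k <= b^2] for all measurable [0 <= k <= lam]
      ([resid_integral]).  Taking [k = lam * (1 - lam)], respectively [k]
      constant, gives [resid (x (phi e)) <= e] in the two cases.

    Metastability then follows by compactness.  Put [delta = eps / 4].  The
    points [x (Delta_step i)], for [i] up to the cover bound, lie in a ball of
    radius [b]; covering its orthonormal coordinates by small cubes and using
    the pigeonhole principle ([ball_pigeonhole]), two of them with indices
    [i < j] are at distance at most [delta / sqrt 12].  The later one,
    [p = x (Delta_step j)], is so nearly fixed - its residual is tuned to [f]
    through [delta_hat] - that the trajectory, being close to [p] at time
    [Delta_step i], stays close to it on the whole interval [n, n + f n]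
    starting at the first integer [n] after [Delta_step i].  Closeness to one
    almost fixed point bounds both the oscillation and the residual there.

    When [2 b <= eps] everything is trivially bounded by [2 b], so that
    [delta < b] can be assumed, which lets distances be used where squared
    distances would otherwise be needed. *)

(** * Growth of absolutely continuous functions *)

Section Growth.
Context {R : realType}.
Implicit Types (a b c K t u v w : R).

(** Cousin's lemma as an induction principle: consider the supremum of the
    [s <= b] for which [Q a s] holds, and cross it using locality there. *)
Lemma cousin_ind (Q : R -> R -> Prop) a b : a <= b ->
  (forall u v w, a <= u -> u <= v -> v <= w -> w <= b ->
    Q u v -> Q v w -> Q u w) ->
  (forall t, a <= t <= b -> exists2 c, 0 < c & forall u v,
    a <= u -> u <= t -> t <= v -> v <= b -> t - c < u -> v < t + c -> Q u v) ->
  Q a b.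
Proof.
move=> ab Qadd Qloc; pose S := [set s : R | a <= s <= b /\ Q a s].
have Sa : S a.
  split; first by rewrite lexx.
  by have [|c c0 H] := Qloc a; [rewrite lexx|apply: H => //; lra].
have ubS : ubound S b by move=> s [/andP[]].
have hS : has_sup S by split; [exists a|exists b].
have as_ : a <= sup S by apply: ub_le_sup => //; exists b.
have sb : sup S <= b by apply: ge_sup => //; exists a.
have [|c c0 Hc] := Qloc (sup S); first by rewrite as_ sb.
have [s [/andP[as' sb'] Qas] ss] := sup_adherent c0 hS.
have sle : s <= sup S.
  by apply: ub_le_sup; [exists b|split => //; rewrite as' sb'].
have [bc|bc] := lerP b (sup S + c / 2).
  by apply: (Qadd a s b) => //; apply: Hc => //; lra.
have Sv : S (sup S + c / 2).
  split; first by apply/andP; split; lra.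
  by apply: (Qadd a s) => //; [lra|lra|apply: Hc => //; lra].
have : sup S + c / 2 <= sup S by apply: ub_le_sup => //; exists b.
lra.
Qed.

(** Outer regularity: a null set lies in open sets of small measure. *)
Lemma ae_open_cover (P : R -> Prop) c : 0 < c ->
  {ae @completed_lebesgue_measure R, forall t, P t} ->
  exists U : set R, [/\ open U, forall t, ~ P t -> U t
    & (lebesgue_measure U < c%:E)%E].
Proof.
move=> c0 [A [mA A0 PA]].
have c20 : 0 < c / 2 by lra.
have [U [oU AU muU]] := outer_measure_open_le A c20.
exists U; split => //; first by move=> t nPt; apply: AU; apply: PA.
apply: (le_lt_trans muU).
have -> : ((wlength idfun)^*%mu A = 0)%E by exact: A0.
by rewrite add0e lte_fin; lra.
Qed.

Definition separated (p q : R * R) : bool := p.2 <= q.1.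

(** Families of intervals are built below by concatenation, which is simpler on
    sequences than on families indexed by ordinals. *)
Lemma abs_continuous_seq (X : normedModType R) a b (g : R -> X) e :
  abs_continuous a b g -> 0 < e -> exists2 c : R, 0 < c &
    forall s : seq (R * R),
      all (fun p => [&& a <= p.1, p.1 <= p.2 & p.2 <= b]) s ->
      pairwise separated s -> \sum_(p <- s) (p.2 - p.1) < c ->
      \sum_(p <- s) `|g p.2 - g p.1| < e.
Proof.
move=> ac e0; have [c c0 H] := ac _ e0; exists c => // s /all_nthP sab sep.
rewrite !(big_nth (0, 0)) !big_mkord; apply: H => [i|i j ij].
  by have /and3P[] := sab (0, 0) i (ltn_ord i).
have /(pairwiseP (0, 0)) sep' := sep.
have [ltij|ltji|/val_inj eij] := ltngtP i j; last by rewrite eij eqxx in ij.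
- by left; apply: sep'; rewrite ?inE.
- by right; apply: sep'; rewrite ?inE.
Qed.

(** The times where the local bound fails are covered by an open set [U] of
    measure below the threshold that absolute continuity associates with a
    small error.  By Cousin's lemma [a, b] splits into small intervals that
    either obey the local bound or lie in [U]; on the latter, absolute
    continuity bounds the total variation of [g].  Measuring their length by
    [U] intersected with a half-open interval makes the splitting additive. *)
Lemma abs_continuous_growth (g : R -> R) a b K : a <= b -> 0 <= K ->
  abs_continuous a b g ->
  {ae @completed_lebesgue_measure R, forall t, a <= t <= b ->
    forall e, 0 < e -> exists2 c, 0 < c & forall u v,
      a <= u -> u <= t -> t <= v -> v <= b -> t - c < u -> v < t + c ->
      g v - g u <= (K + e) * (v - u)} ->
  g b - g a <= K * (b - a).
Proof.
move=> ab K0 ac gD; apply/ler_addgt0Pr => e e0.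
have e20 : 0 < e / 2 by lra.
have [c c0 Hc] := abs_continuous_seq ac e20.
have [U [oU nU muU]] := ae_open_cover c0 gD.
have mU : measurable U by exact: measurable_realfun.open_measurable.
pose mu : {measure set (measurableTypeR R) -> \bar R} := @lebesgue_measure R.
have mUI u v : measurable (U `&` `]u, v]) by exact: measurableI.
have finU : (mu U < +oo)%E by rewrite (lt_trans muU)// ltry.
have finUI u v : mu (U `&` `]u, v]) \is a fin_num.
  rewrite ge0_fin_numE// (le_lt_trans _ finU)// le_measure// inE//; exact: mUI.
have finUt : mu U \is a fin_num by rewrite ge0_fin_numE.
(* Half of the error [e] pays for the local bounds, half for the part in [U]. *)
pose k := e / (2 * (b - a + 1)).
have k0 : 0 < k by rewrite /k divr_gt0//; lra.
pose Q u v := exists s : seq (R * R), [/\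
  all (fun p => [&& u <= p.1, p.1 <= p.2 & p.2 <= v]) s,
  pairwise separated s,
  \sum_(p <- s) (p.2 - p.1) <= fine (mu (U `&` `]u, v])) &
  g v - g u <= (K + k) * (v - u) + \sum_(p <- s) `|g p.2 - g p.1|].
suff [s [s1 s2 s3 s4]] : Q a b.
  have muUfin : fine (mu U) < c.
    by rewrite -lte_fin fineK.
  have s5 : \sum_(p <- s) (p.2 - p.1) < c.
    apply: le_lt_trans muUfin; apply: (le_trans s3).
    by rewrite fine_le ?finUI ?finUt// le_measure ?inE//; exact: mUI.
  have := Hc _ s1 s2 s5.
  have : k * (b - a) <= e / 2.
    rewrite /k invfM mulrA -mulrA ger_pMr// mulrC ler_pdivrMr; lra.
  lra.
apply: cousin_ind => // [u v w au uv vw wb [s [s1 s2 s3 s4]] [r [r1 r2 r3 r4]]|].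
  exists (s ++ r); rewrite !big_cat all_cat pairwise_cat/=; split.
  - apply/andP; split; [apply: sub_all s1|apply: sub_all r1] => p /and3P[*];
      apply/and3P; split; lra.
  - rewrite s2 r2 !andbT; apply/allrelP => p q ps qr; rewrite /separated.
    move/allP: s1 => /(_ _ ps)/and3P[_ _ ?].
    move/allP: r1 => /(_ _ qr)/and3P[? _ _]; lra.
  - have -> : U `&` `]u, w] = (U `&` `]u, v]) `|` (U `&` `]v, w]).
      rewrite -setIUr; congr (_ `&` _).
      by rewrite (itv_bndbnd_setU (x := BRight v))//= bnd_simp.
    rewrite measureU//; [by rewrite fineD ?finUI// lerD|exact: mUI|exact: mUI|].
    apply/seteqP; split => // z [[_ +] [_ +]] /=.
    move=> /andP[_ zv] /andP[vz _]; move: zv vz; rewrite !bnd_simp => zv vz.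
    by have := le_lt_trans zv vz; rewrite ltxx.
  - lra.
move=> t /andP[ta tb].
have [gt|] := pselect (a <= t <= b ->
    forall e, 0 < e -> exists2 c, 0 < c & forall u v,
      a <= u -> u <= t -> t <= v -> v <= b -> t - c < u -> v < t + c ->
      g v - g u <= (K + e) * (v - u)).
  have [|h h0 H] := gt _ _ k0; first by rewrite ta tb.
  exists h => // u v *; exists [::]; rewrite !big_nil; split => //.
  by rewrite addr0; exact: H.
move=> /nU Ut; have /nbhs_ballP[h /= h0 hU] : nbhs t U.
  by move: oU; rewrite openE => /(_ _ Ut).
exists h => // u v au ut tv vb tu vt; exists [:: (u, v)].
rewrite !big_seq1/=; split => //.
- by rewrite !lexx (le_trans ut tv).
- have -> : U `&` `]u, v] = `]u, v]%classic.
    apply/setIidPr => z /=; rewrite in_itv/= => /andP[uz zv]; apply: hU.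
    by rewrite /ball/= ltr_distl; lra.
  rewrite /mu lebesgue_measure_itv/= lte_fin; case: ifP => // /negbT.
  by rewrite -leNgt => vu; rewrite /= ; lra.
- have := ler_norm (g v - g u).
  have : 0 <= (K + k) * (v - u) by rewrite mulr_ge0//; lra.
  lra.
Qed.

End Growth.

(** * Infinitesimal behaviour of the flow *)

Section Flow.
Context {R : realType}.

Lemma is_derive_approx (X : normedModType R) (x : R -> X) (t : R) (w : X) e :
  is_derive t 1 x w -> 0 < e -> exists2 c, 0 < c & forall s, `|s - t| < c ->
    `|x s - x t - (s - t) *: w| <= e * `|s - t|.
Proof.
move=> dx e0.
have cv : h^-1 *: ((x \o shift t) (h *: (1 : R^o)) - x t) @[h --> 0^'] --> w.
  by have /cvg_ex[l xl] := @ex_derive _ _ _ _ _ _ _ dx;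
    rewrite -(derive_val (is_derive := dx)) /derive (cvg_lim _ xl).
have /cvgr_dist_le/(_ _ e0) := cv.
rewrite near_withinE => /nbhs_ballP[c /= c0 H]; exists c => // s sc.
have [->|st] := eqVneq s t; first by rewrite !subrr scale0r subr0 !normr0 mulr0.
have st0 : s - t != 0 by rewrite subr_eq0.
have /H : ball 0 c (s - t) by rewrite /ball/= sub0r normrN.
move=> /(_ st0); rewrite /= [(s - t) *: _]mulr1 subrK => le.
have -> : x s - x t - (s - t) *: w
    = (s - t) *: - (w - (s - t)^-1 *: (x s - x t)).
  by rewrite opprB scalerBr scalerA divff// scale1r.
by rewrite normrZ normrN mulrC ler_wpM2r.
Qed.

Lemma abs_continuous_lip (X : normedModType R) (C a b : R) (x : R -> X)
    (g : R -> R) : 0 < C ->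
  (forall u v, `|g v - g u| <= C * `|x v - x u|) ->
  abs_continuous a b x -> abs_continuous a b g.
Proof.
move=> C0 gx ac e e0; have [|c c0 H] := ac (e / C); first exact: divr_gt0.
exists c => // n u v uv sep len.
apply: (@le_lt_trans _ _ (C * \sum_i `|x (v i) - x (u i)|)).
  by rewrite mulr_sumr ler_sum.
by rewrite mulrC -ltr_pdivlMr//; exact: H.
Qed.

Lemma abs_continuousS (X : normedModType R) (a b a' b' : R) (x : R -> X) :
  a <= a' -> b' <= b -> abs_continuous a b x -> abs_continuous a' b' x.
Proof.
move=> aa bb ac e e0; have [c c0 H] := ac e e0; exists c => // n u v uv.
apply: H => i; have [*] := uv i; split; lra.
Qed.


(** This lemma and the next are the forward and backward estimates for an Euler
    step of size [k] from [A] towards [D].  The backward one holds for all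
    [k >= 0] since [(1 + k) A] is the backward step plus [k D]. *)
Lemma norm_relax_le (X : normedModType R) (A D : X) (k m : R) :
  0 <= k <= 1 -> `|D| <= `|A| + m -> `|A + k *: (D - A)| <= `|A| + k * m.
Proof.
move=> /andP[k0 k1] DA; have -> : A + k *: (D - A) = (1 - k) *: A + k *: D.
  by rewrite scalerBl scale1r scalerBr addrA addrAC.
apply: (le_trans (ler_normD _ _)); rewrite !normrZ !ger0_norm ?subr_ge0//.
have := ler_wpM2l k0 DA; lra.
Qed.

Lemma norm_relax_ge (X : normedModType R) (A D : X) (k m : R) :
  0 <= k -> `|D| <= `|A| + m -> `|A| - k * m <= `|A - k *: (D - A)|.
Proof.
move=> k0 DA; have E : (1 + k) *: A = (A - k *: (D - A)) + k *: D.
  by rewrite scalerDl scale1r scalerBr opprB addrA subrK.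
have : `|(1 + k) *: A| <= `|A - k *: (D - A)| + k * `|D|.
  by rewrite E (le_trans (ler_normD _ _))// normrZ ger0_norm.
rewrite normrZ ger0_norm ?addr_ge0//.
have := ler_wpM2l k0 DA; lra.
Qed.

Context (X : finDimBanachType R) (T : X -> X) (hT : nonexpansive T).

Definition resid (z : X) : R := `|T z - z|.

Lemma resid_lip (u v : X) : `|resid v - resid u| <= 2 * `|v - u|.
Proof.
rewrite (le_trans (ler_dist_dist _ _))//.
have -> : T v - v - (T u - u) = (T v - T u) - (v - u).
  by rewrite !opprB addrACA [RHS]addrACA (addrC (- v)).
rewrite (le_trans (ler_normB _ _))//; have := hT v u; lra.
Qed.

(** With [A = x t - p] and [D = T (x t) - p], nonexpansiveness gives
    [|D| <= |A| + resid p]; the first-order expansion of [x] at [t] is an Euler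
    step from [A] towards [D], forward on the right and backward on the left. *)
Lemma dist_local_growth (x : R -> X) (t l e : R) (p : X) : 0 <= l <= 1 ->
  is_derive t 1 x (l *: (T (x t) - x t)) -> 0 < e ->
  exists2 c, 0 < c & forall u v, u <= t -> t <= v -> t - c < u -> v < t + c ->
    `|x v - p| - `|x u - p| <= (resid p + e) * (v - u).
Proof.
move=> /andP[l0 l1] dx e0; have [c c0 H] := is_derive_approx dx e0.
exists (Num.min c 1) => [|u v ut tv tu vt]; first by rewrite lt_min c0 /=.
have [uc u1] : t - u < c /\ t - u < 1.
  by apply/andP; rewrite -lt_min ltrBlDr -ltrBlDl.
have [vc v1] : v - t < c /\ v - t < 1 by apply/andP; rewrite -lt_min ltrBlDl.
have DA : `|T (x t) - p| <= `|x t - p| + resid p.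
  have -> : T (x t) - p = (T (x t) - T p) + (T p - p) by rewrite addrA subrK.
  by rewrite (le_trans (ler_normD _ _))// lerD2r.
have wE : T (x t) - x t = (T (x t) - p) - (x t - p) by rewrite opprB addrA subrK.
have r0 : 0 <= resid p by exact: normr_ge0.
have kb h : 0 <= h -> h * l * resid p <= h * resid p.
  by move=> h0; rewrite ler_wpM2r// ler_piMr.
have vle : `|x v - p| <= `|x t - p| + (v - t) * resid p + e * (v - t).
  have -> : x v - p = (x t - p + ((v - t) * l) *: (T (x t) - p - (x t - p)))
      + (x v - x t - (v - t) *: (l *: (T (x t) - x t))).
    by rewrite -wE scalerA addrACA subrr addr0 addrC addrA subrK.
  have /H : `|v - t| < c by rewrite ger0_norm// subr_ge0.
  rewrite (ger0_norm (x := v - t)) ?subr_ge0// => Hv.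
  apply: (le_trans (ler_normD _ _)); apply: lerD => //.
  apply: le_trans (norm_relax_le _ DA) _; last by rewrite lerD2l kb// subr_ge0.
  by rewrite mulr_ge0 ?subr_ge0//= mulr_ile1// ?subr_ge0// ltW.
have ule : `|x t - p| - (t - u) * resid p - e * (t - u) <= `|x u - p|.
  have := norm_relax_ge _ DA (k := (t - u) * l).
  rewrite mulr_ge0 ?subr_ge0// => /(_ isT).
  have -> : x t - p - ((t - u) * l) *: (T (x t) - p - (x t - p)) = (x u - p)
      - (x u - x t - (u - t) *: (l *: (T (x t) - x t))).
    rewrite -wE scalerA -[u - t]opprB mulNr scaleNr opprK opprD opprB addrA.
    by congr (_ - _); rewrite addrC addrA subrK.
  have /H : `|u - t| < c by rewrite distrC ger0_norm// subr_ge0.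
  rewrite (distrC u t) (ger0_norm (x := t - u)) ?subr_ge0// => Hu h.
  have := ler_normB (x u - p) (x u - x t - (u - t) *: (l *: (T (x t) - x t))).
  have : (t - u) * l * resid p <= (t - u) * resid p by rewrite kb// subr_ge0.
  lra.
lra.
Qed.

(** Moving [x] by [h * lam] times [w = T (x t) - x t] shortens the distance to
    [T (x t)] by [h * lam * |w|], while [T x] moves by no more than [x] does,
    that is by at most [h * lam * |w|]: the two effects compensate. *)
Lemma resid_local_growth (x : R -> X) (t l e : R) : 0 <= l <= 1 ->
  is_derive t 1 x (l *: (T (x t) - x t)) -> 0 < e ->
  exists2 c, 0 < c & forall u v, u <= t -> t <= v -> t - c < u -> v < t + c ->
    resid (x v) - resid (x u) <= e * (v - u).
Proof.
move=> /andP[l0 l1] dx e0; have e20 : 0 < e / 2 by rewrite divr_gt0.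
have [c c0 H] := is_derive_approx dx e20.
exists (Num.min c 1) => [|u v ut tv tu vt]; first by rewrite lt_min c0 /=.
have [uc u1] : t - u < c /\ t - u < 1.
  by apply/andP; rewrite -lt_min ltrBlDr -ltrBlDl.
have [vc v1] : v - t < c /\ v - t < 1 by apply/andP; rewrite -lt_min ltrBlDl.
set w := T (x t) - x t in dx H *.
have approx s : `|s - t| < c ->
    `|x s - x t| <= `|s - t| * l * `|w| + e / 2 * `|s - t| /\
    `|(T (x t) - x s) - (1 - (s - t) * l) *: w| <= e / 2 * `|s - t|.
  move=> /H Hs; split.
    rewrite -{1}[x s - x t](subrK ((s - t) *: (l *: w))).
    rewrite (le_trans (ler_normD _ _))// addrC lerD//.
    by rewrite scalerA normrZ normrM (ger0_norm l0).
  rewrite (_ : _ - _ *: w = - (x s - x t - (s - t) *: (l *: w))) ?normrN//.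
  rewrite scalerBl scale1r scalerA !opprB.
  by rewrite addrC -[in LHS]addrA; congr (_ + _); rewrite addrA subrK.
have vle : resid (x v) <= `|w| + e * (v - t).
  have /approx[] : `|v - t| < c by rewrite ger0_norm// subr_ge0.
  rewrite (ger0_norm (x := v - t)) ?subr_ge0// => a1 a2.
  have := ler_normD (T (x v) - T (x t)) (T (x t) - x v).
  rewrite addrA subrK -/(resid _) => a3.
  have := hT (x v) (x t).
  have := ler_normD (T (x t) - x v - (1 - (v - t) * l) *: w)
    ((1 - (v - t) * l) *: w).
  rewrite subrK normrZ [`|1 - _|]ger0_norm; last first.
    by rewrite subr_ge0 mulr_ile1// ?subr_ge0// ltW.
  lra.
have ule : `|w| - e * (t - u) <= resid (x u).
  have /approx[] : `|u - t| < c by rewrite distrC ger0_norm// subr_ge0.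
  rewrite (distrC u t) (ger0_norm (x := t - u)) ?subr_ge0// => a1 a2.
  have := ler_normD (T (x t) - T (x u)) (T (x u) - x u).
  rewrite addrA subrK -/(resid _) => a3.
  have := hT (x t) (x u); rewrite (distrC (x t)).
  have := ler_normB (T (x t) - x u)
    (T (x t) - x u - (1 - (u - t) * l) *: w).
  rewrite subKr normrZ [`|1 - _|]ger0_norm; last first.
    by rewrite -mulNr opprB addr_ge0// mulr_ge0// subr_ge0.
  lra.
lra.
Qed.

Context (lam : R -> R) (hlam : forall t : R, 0 <= t -> 0 <= lam t <= 1).
Context (x0 : X) (x : R -> X) (hx : strong_global_solution lam T x0 x).

Lemma solution_abs_continuous a b : 0 <= a -> abs_continuous a b x.
Proof.
move=> a0; have [/(_ (Num.max b 1)) H _ _] := hx.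
by apply: abs_continuousS a0 _ (H _); rewrite ?lt_max ?ltr01 ?orbT// le_max lexx.
Qed.

(** All functions compared along the flow are 2-Lipschitz functions of [x t], so
    that they inherit the absolute continuity of [x]. *)
Lemma solution_growth (g : R -> R) (K a b : R) : 0 <= a <= b -> 0 <= K ->
  (forall u v, `|g v - g u| <= 2 * `|x v - x u|) ->
  (forall t e : R, 0 <= t -> is_derive t 1 x (lam t *: (T (x t) - x t)) -> 0 < e ->
    exists2 c, 0 < c & forall u v : R,
      u <= t -> t <= v -> t - c < u -> v < t + c ->
      g v - g u <= (K + e) * (v - u)) ->
  g b - g a <= K * (b - a).
Proof.
move=> /andP[a0 ab] K0 gx gloc; apply: abs_continuous_growth => //.
  by apply: abs_continuous_lip gx _ => //; exact: solution_abs_continuous.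
have [_ _ [A [mA A0 notA]]] := hx; exists A; split => //.
apply: subset_trans notA; apply: subsetC => t /= dx /andP[at_ _] e e0.
have t0 : 0 <= t by exact: le_trans at_.
have [c c0 H] := gloc t e t0 (dx t0) e0.
by exists c => // u v _ ut tv _; exact: H.
Qed.

Lemma dist_growth p a b : 0 <= a <= b ->
  `|x b - p| <= `|x a - p| + resid p * (b - a).
Proof.
move=> ab; rewrite -lerBlDl.
apply: (@solution_growth (fun t => `|x t - p|) _ _ _ ab) => [|u v|t e t0 dx e0].
- exact: normr_ge0.
- rewrite (le_trans (ler_dist_dist _ _))// opprB addrA subrK.
  by rewrite ler_peMl// ler1n.
- by apply: dist_local_growth dx e0; exact: hlam.
Qed.

Lemma resid_nonincreasing a b : 0 <= a <= b -> resid (x b) <= resid (x a).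
Proof.
move=> ab; rewrite -subr_le0 -(mul0r (b - a)).
apply: (@solution_growth (fun t => resid (x t)) _ _ _ ab) => // [u v|t e t0 dx e0].
  exact: resid_lip.
have [c c0 H] := resid_local_growth (hlam t0) dx e0.
by exists c => // u v *; rewrite add0r; exact: H.
Qed.

End Flow.

(** * Integrals bounded by the decrease of a function *)

Section Slope.
Context {R : realType}.
Implicit Types (G k : R -> R) (h r t : R).

(** Starting the integral at -1 makes 0 an interior point. *)
Lemma continuous_primitive G : continuous G ->
  exists F : R -> R, forall t, 0 <= t -> is_derive t 1 F (G t).
Proof.
move=> cG; exists (fun u => \int[lebesgue_measure]_(s in `[-1, u]) G s) => t t0.
have int : (@lebesgue_measure R).-integrable `[-1, t + 1] (EFin \o G).
  apply: continuous_compact_integrable; first exact: segment_compact.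
  exact: continuous_subspaceT.
have tt1 : t < t + 1 by rewrite ltrDl.
have [||dF F'] := continuous_FTC1 tt1 int.
- by rewrite /= lte_fin; lra.
- exact: cG.
- by apply: DeriveDef; [exact: dF|rewrite -derive1E; exact: F'].
Qed.

Lemma shift_slope_continuous G h : continuous G ->
  continuous (fun t => h^-1 * (G t - G (t + h))).
Proof.
move=> cG t; apply: cvgM; first exact: cvg_cst.
apply: cvgB; first exact: cG.
apply: (@continuous_comp _ _ _ (fun s : R => s + h) G); last exact: cG.
by apply: cvgD; [exact: cvg_id|exact: cvg_cst].
Qed.

(** For a primitive [F] of [G] the integral equals
    [((F h - F 0) - (F (r + h) - F r)) / h], a difference of two mean values of
    [G], the first one at most [G 0] and the second one nonnegative. *)
Lemma integral_shift_slope_le G h r : 0 < h -> 0 <= r -> continuous G ->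
  (forall t, 0 <= G t) -> (forall t, 0 <= t -> G t <= G 0) ->
  (\int[@lebesgue_measure R]_(t in `[0%R, r])
     (h^-1 * (G t - G (t + h)))%:E <= (G 0)%:E)%E.
Proof.
move=> h0; rewrite le_eqVlt => /predU1P[<- _ G0 _|r0 cG G0 Gle].
  by rewrite set_itv1 integral_set1 lee_fin.
have [F dF] := continuous_primitive cG.
have mvt a b : 0 <= a -> a < b ->
    exists2 c, 0 <= c & F b - F a = G c * (b - a).
  move=> a0 ab; have dFab s : s \in `[a, b] -> is_derive s 1 F (G s).
    by rewrite in_itv/= => /andP[sa _]; apply: dF; exact: le_trans sa.
  have dFoo s : s \in `]a, b[ -> is_derive s 1 F (G s).
    by rewrite in_itv/= => /andP[sa _]; apply: dF; rewrite (le_trans a0)// ltW.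
  have cF : {within `[a, b], continuous F}.
    by apply: derivable_within_continuous => s /dFab[].
  have [c] := MVT ab dFoo cF.
  rewrite in_itv/= => /andP[ac _] E; exists c => //.
  by rewrite (le_trans a0)// ltW.
pose H t := h^-1 * (F t - F (t + h)).
have dH t : 0 <= t -> is_derive t 1 H (h^-1 * (G t - G (t + h))).
  move=> t0; have d1 := dF t t0.
  have d2 : is_derive (t + h) 1 F (G (t + h)) by apply: dF; lra.
  have d3 : is_derive t 1 (F \o shift h) (G (t + h)).
    have ds : is_derive t (1 : R) (shift h) 1 by exact: is_derive_shift.
    by have := @is_derive1_comp _ F (shift h) t _ _ d2 ds; rewrite mulr1.
  exact: is_deriveZ (is_deriveB d1 d3).
have cH t : 0 <= t -> {for t, continuous H}.
  move=> t0; apply: differentiable_continuous; apply/derivable1_diffP.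
  by have [] := dH t t0.
rewrite (@continuous_FTC2 _ _ H) //.
- have rrh : r < r + h by rewrite ltrDl.
  have [c1 c10] := mvt 0 h (lexx 0) h0; rewrite subr0 => E1.
  have [c2 c20] := mvt r (r + h) (ltW r0) rrh; rewrite addrAC subrr add0r => E2.
  rewrite -EFinB lee_fin /H add0r -mulrBr.
  have -> : F r - F (r + h) - (F 0 - F h) = h * (G c1 - G c2) by lra.
  by rewrite mulKf ?gt_eqF//; have := Gle _ c10; have := G0 c2; lra.
- apply: continuous_subspaceT => t; exact: shift_slope_continuous.
- split.
  + by move=> t; rewrite in_itv/= => /andP[/ltW/dH[]].
  + apply: cvg_at_right_filter; exact: cH.
  + apply: cvg_at_left_filter; apply: cH; exact: ltW.
- move=> t; rewrite in_itv/= => /andP[/ltW/dH dt _].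
  by rewrite derive1E; case: dt.
Qed.

Lemma limn_einf_ge (u : (\bar R)^nat) (l : R) :
  (forall e, 0 < e -> \forall n \near \oo, ((l - e)%:E <= u n)%E) ->
  (l%:E <= limn_einf u)%E.
Proof.
move=> H; apply/lee_subgt0Pr => e e0; have [N _ HN] := H _ e0.
rewrite limn_einf_lim -EFinB; apply: lime_ge; first exact: is_cvg_einfs.
exists N => // n /= Nn; apply: le_ereal_inf_tmp => _ [m /= nm <-].
by apply: HN => /=; exact: leq_trans nm.
Qed.

Lemma measurable_fun_limn_einf d (T : measurableType d) (D : set T)
    (f : (T -> \bar R)^nat) : (forall n, measurable_fun D (f n)) ->
  measurable_fun D (fun x => limn_einf (f ^~ x)).
Proof.
move=> mf; rewrite /limn_einf.
apply: (@measurableT_comp _ _ _ _ _ _ -%E) => //.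
apply: measurable_fun_limn_esup => n.
by apply: (@measurableT_comp _ _ _ _ _ _ -%E) => //.
Qed.

Lemma limn_einf_le (u : (\bar R)^nat) (l : \bar R) :
  (forall n, (u n <= l)%E) -> (limn_einf u <= l)%E.
Proof.
move=> H; rewrite limn_einf_lim; apply: lime_le; first exact: is_cvg_einfs.
by apply: nearW => n; apply: le_trans (H n); apply: ereal_inf_lbound; exists n => /=.
Qed.

Let borel_lebesgue_id :
  measurable_fun setT (id : lebesgueTypeR R -> measurableTypeR R).
Proof. by move=> _ B mB; rewrite setTI; exact: sub_caratheodory. Qed.

(** The identity is measurable from Lebesgue to Borel sets and pushes the
    completed measure forward to the Borel one. *)
Lemma ge0_integral_completed (D : set R) (g : R -> \bar R) :
  measurable (D : set (measurableTypeR R)) ->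
  measurable_fun (D : set (measurableTypeR R)) g ->
  (forall t, D t -> (0 <= g t)%E) ->
  (\int[@completed_lebesgue_measure R]_(t in D) g t =
   \int[@lebesgue_measure R]_(t in D) g t)%E.
Proof.
move=> mD mg g0.
have := @ge0_integral_pushforward _ _ _ _ _ _ borel_lebesgue_id
  (@completed_lebesgue_measure R) D g mD mg.
rewrite preimage_id => <-; last by move=> t; rewrite inE; exact: g0.
by [].
Qed.

Lemma set_itvccP (a b t : R) : `[a, b]%classic t -> a <= t <= b.
Proof. by rewrite /= in_itv. Qed.

(** The easy half of the fundamental theorem of calculus for monotone functions:
    by Fatou's lemma the integral of [k] is at most the lower limit of the
    integrals of the difference quotients of [G].  No differentiability of the
    integral of [k] is involved, which matters as [k] is only Lebesgue
    measurable. *)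
Lemma integral_le_of_slope G k r : 0 <= r -> continuous G ->
  (forall t, 0 <= G t) -> {homo G : u v /~ u <= v} ->
  lebesgue_measurable_fun `[0, r] k -> (forall t, 0 <= t <= r -> 0 <= k t) ->
  {ae @completed_lebesgue_measure R, forall t, 0 <= t <= r ->
    forall e : R, 0 < e -> exists2 c, 0 < c & forall h, 0 < h < c ->
      (k t - e) * h <= G t - G (t + h)} ->
  (\int[@completed_lebesgue_measure R]_(t in `[0%R, r]) (k t)%:E
     <= (G 0)%:E)%E.
Proof.
move=> r0 cG G0 Gni mk k0 slope.
pose h n : R := n.+1%:R^-1.
have h0 n : 0 < h n by rewrite invr_gt0.
pose D n t := ((h n)^-1 * (G t - G (t + h n)))%:E.
have D0 n t : (0 <= D n t)%E.
  by rewrite lee_fin mulr_ge0 ?invr_ge0 ?(ltW (h0 n))// subr_ge0 Gni// lerDl ltW.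
have mitv : measurable (`[0, r]%classic : set (measurableTypeR R)).
  exact: measurable_itv.
have mD n : measurable_fun setT (D n : measurableTypeR R -> \bar R).
  apply/measurable_EFinP; apply: continuous_measurable_fun.
  exact: shift_slope_continuous.
have mitvL : measurable (`[0, r]%classic : set (lebesgueTypeR R)).
  exact: sub_caratheodory.
have mDL n : measurable_fun (`[0, r]%classic : set (lebesgueTypeR R)) (D n).
  apply: (@measurable_funS _ _ _ _ setT) => //.
  exact: (measurableT_comp (mD n) borel_lebesgue_id).
apply: (@le_trans _ _ (\int[@completed_lebesgue_measure R]_(t in `[0%R, r])
   limn_einf (D ^~ t))%E); last first.
  apply: (le_trans (fatou _ _ _ _)) => //.
  apply: limn_einf_le => n; rewrite ge0_integral_completed//.
    by apply: integral_shift_slope_le => // t t0; exact: Gni.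
  exact: measurable_funS (mD n).
apply: ae_ge0_le_integral.
- exact: mitvL.
- by move=> t /set_itvccP tr; rewrite lee_fin k0.
- exact/measurable_EFinP.
- move=> t _; apply: limn_einf_ge => e e0; apply: nearW => n.
  by apply: le_trans (D0 n t); rewrite lee_fin sub0r oppr_le0 ltW.
- exact: measurable_fun_limn_einf.
have [A [mA A0 notA]] := slope; exists A; split => //.
apply: subset_trans notA; apply: subsetC => t /= H.
move=> tr; move: (H (set_itvccP tr)) => {}H; apply: limn_einf_ge => e /H[c c0 {}H].
near=> n; rewrite lee_fin mulrC ler_pdivlMr//; apply: H; rewrite h0/=.
by near: n; exact: near_infty_natSinv_lt (PosNum c0).
Unshelve. all: by end_near.
Qed.
End Slope.

(** * Inner products and the pigeonhole principle in a ball *)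

Section Inner.
Context {R : realType} {X : finDimBanachType R} (ip : {dot X for idfun})
  (hip : is_inner_product ip).
Implicit Types (u v w : X) (s : seq X).

Lemma ipC u v : ip u v = ip v u.
Proof. by rewrite hermC expr0 mul1r. Qed.

Lemma ip_ge0 u : 0 <= ip u u.
Proof.
by have [->|/(neq0_dnorm_gt0 (s := ip))/ltW] := eqVneq u 0; rewrite ?linear0l.
Qed.

Lemma sqr_norm_ip u : `|u| ^+ 2 = ip u u.
Proof. by rewrite hip sqr_sqrtr// ip_ge0. Qed.

Lemma sqr_normD u v : `|u + v| ^+ 2 = `|u| ^+ 2 + 2 * ip u v + `|v| ^+ 2.
Proof.
rewrite !sqr_norm_ip linearDl !linearDr/= (ipC v u).
by rewrite mulr_natl mulr2n !addrA.
Qed.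

(** [|D| <= |A|] says that [2 <A, D - A> <= - |D - A|^2]. *)
Lemma sqr_norm_relax (A D : X) (k : R) : 0 <= k -> `|D| <= `|A| ->
  `|A + k *: (D - A)| ^+ 2 <= `|A| ^+ 2 - k * (1 - k) * `|D - A| ^+ 2.
Proof.
move=> k0 DA; have DE : A + (D - A) = D by rewrite addrC subrK.
move: (D - A) DE => W DE.
have : `|A + W| ^+ 2 <= `|A| ^+ 2 by rewrite DE ler_sqr ?nnegrE.
rewrite !sqr_normD linearZr_LR normrZ exprMn ger0_norm//=.
set i := ip _ _; set n := `|W| ^+ 2 => le.
have : k * (2 * i) <= k * (- n) by rewrite ler_wpM2l//; lra.
by rewrite expr2; lra.
Qed.

Definition orthonormal_seq s := forall i j, (i < size s)%N -> (j < size s)%N ->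
  ip s`_i s`_j = (i == j)%:R.

(** The component of [u] orthogonal to the vectors of [s], when these are
    orthonormal. *)
Definition proj_rest s u := u - \sum_(i < size s) ip u s`_i *: s`_i.

Lemma ip_proj_rest s u j : orthonormal_seq s -> (j < size s)%N ->
  ip (proj_rest s u) s`_j = 0.
Proof.
move=> os js; rewrite linearBl linear_sumlz/= (bigD1 (Ordinal js))//=.
rewrite linearZl_LR/= os// eqxx mulr1 big1 ?addr0 ?subrr// => i ij.
by rewrite linearZl_LR/= os// -[j]/(val (Ordinal js)) val_eqE (negPf ij) mulr0.
Qed.

Lemma orthonormal_seq_rcons s u : orthonormal_seq s -> proj_rest s u != 0 ->
  orthonormal_seq (rcons s (`|proj_rest s u|^-1 *: proj_rest s u)).
Proof.
move=> os r0 i j; rewrite size_rcons !ltnS !nth_rcons.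
have sE k : (k <= size s)%N -> (k < size s)%N = (k != size s).
  by move=> ks; rewrite ltn_neqAle ks andbT.
move=> ile jle; rewrite !sE//.
have [->|ins] := eqVneq i (size s); have [->|jns] := eqVneq j (size s) => /=.
- rewrite linearZl_LR linearZr_LR/= ?eqxx -sqr_norm_ip.
  by rewrite expr2 mulKf ?mulVf ?normr_eq0.
- by rewrite linearZl_LR/= ip_proj_rest ?sE// mulr0.
- by rewrite ipC linearZl_LR/= ip_proj_rest ?sE// mulr0 (negPf ins).
- by rewrite os ?sE.
Qed.

Lemma orthonormal_seq_size s : orthonormal_seq s -> (size s <= \dim {:X})%N.
Proof.
move=> os; have fs : free s.
  rewrite -(in_tupleE s); apply/freeP => a as0 j.
  have : ip (\sum_(i < size s) a i *: s`_i) s`_j = 0 by rewrite as0 linear0l.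
  rewrite linear_sumlz/= (bigD1 j)//= linearZl_LR/= os// eqxx mulr1.
  by rewrite big1 ?addr0// => i ij; rewrite linearZl_LR/= os// val_eqE (negPf ij) mulr0.
by rewrite -(eqP fs) dimvS// subvf.
Qed.

(** An orthonormal family that cannot be extended by Gram-Schmidt is complete.
    It is indexed by some [m <= \dim {:X}]: this inequality is all that the
    pigeonhole argument needs. *)
Lemma orthonormal_coordinates : exists m (e : 'I_m -> X),
  (m <= \dim {:X})%N /\ forall u, `|u| ^+ 2 = \sum_i ip u (e i) ^+ 2.
Proof.
suff [s os complete] : exists2 s, orthonormal_seq s & forall u, proj_rest s u = 0.
  exists (size s), (fun i => s`_i); split; first exact: orthonormal_seq_size.
  move=> u; rewrite sqr_norm_ip {1}(subr0_eq (complete u)) linear_sumlz/=.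
  by apply: eq_bigr => i _; rewrite linearZl_LR/= ipC expr2.
suff extend n : forall s, (\dim {:X} < size s + n)%N -> orthonormal_seq s ->
    exists2 s, orthonormal_seq s & forall u, proj_rest s u = 0.
  exact: (extend (\dim {:X}).+1 [::]).
elim: n => [s|n IHn s sn os].
  by rewrite addn0 => sn /orthonormal_seq_size /(leq_trans sn); rewrite ltnn.
have [|/existsNP[u /eqP r0]] := pselect (forall u, proj_rest s u = 0).
  by exists s.
apply: IHn (orthonormal_seq_rcons os r0).
by rewrite size_rcons addSnnS.
Qed.

(** Capping at [M] puts the right end point of [0, M + 1] in the last cell. *)
Lemma truncn_cell (y : R) (M : nat) : 0 <= y <= M.+1%:R ->
  (minn (Num.truncn y) M)%:R <= y <= (minn (Num.truncn y) M)%:R + 1.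
Proof.
move=> /andP[y0 yM]; have /andP[ty yt] := truncn_itv y0.
have [tM|Mt] := leqP (Num.truncn y) M.
  by rewrite ty/= natr1 ltW.
by rewrite natr1 yM andbT (le_trans _ ty)// ler_nat ltnW.
Qed.

(** The cube containing the ball is divided into [M + 1] slices along each of
    the coordinates; two of more than [(M + 1) ^ \dim {:X}] points share a cell,
    whose diameter is at most the bound in the conclusion. *)
Lemma ball_pigeonhole (b : R) (M n : nat) (z : 'I_n -> X) : 0 < b ->
  (M.+1 ^ \dim {:X} < n)%N -> (forall i, `|z i| <= b) ->
  exists i j : 'I_n, (i < j)%N /\
    `|z i - z j| <= Num.sqrt (\dim {:X})%:R * (2 * b / M.+1%:R).
Proof.
move=> b0 Mn zb; have [m [e [md parseval]]] := orthonormal_coordinates.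
have ip_le u l : `|ip u (e l)| <= `|u|.
  rewrite -ler_sqr ?nnegrE// parseval real_normK ?num_real// (bigD1 l)//=.
  by rewrite lerDl sumr_ge0// => *; exact: sqr_ge0.
pose y i l : R := (ip (z i) (e l) + b) * (M.+1%:R / (2 * b)).
have y_itv i l : 0 <= y i l <= M.+1%:R.
  have := le_trans (ip_le (z i) l) (zb i); rewrite ler_norml => /andP[h1 h2].
  rewrite /y mulrA; apply/andP; split.
    by rewrite divr_ge0// ?mulr_ge0//; lra.
  by rewrite ler_pdivrMr; [rewrite mulrC ler_wpM2l//; lra|lra].
pose cell i : {ffun 'I_m -> 'I_M.+1} :=
  [ffun l => inord (minn (Num.truncn (y i l)) M)].
have /injectivePn[i [j ij cij]] : ~~ injectiveb cell.
  apply/negP => /injectiveP /leq_card; rewrite card_ffun !card_ord leqNgt.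
  by rewrite (leq_ltn_trans _ Mn)// leq_pexp2l.
suff le : `|z i - z j| <= Num.sqrt (\dim {:X})%:R * (2 * b / M.+1%:R).
  have [ltij|ltji|/val_inj eij] := ltngtP i j; last by rewrite eij eqxx in ij.
  - by exists i, j.
  - by exists j, i; rewrite distrC.
have coord l : ip (z i - z j) (e l) ^+ 2 <= (2 * b / M.+1%:R) ^+ 2.
  have : minn (Num.truncn (y i l)) M = minn (Num.truncn (y j l)) M.
    move/ffunP: cij => /(_ l); rewrite !ffunE => /(congr1 val).
    by rewrite /= !inordK// ltnS geq_minr.
  have := truncn_cell (y_itv i l); have := truncn_cell (y_itv j l).
  move=> + + E; rewrite E => /andP[j1 j2] /andP[i1 i2].
  have : `|y i l - y j l| <= 1 by rewrite ler_norml; lra.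
  rewrite /y -mulrBl normrM [`|_ / _|]gtr0_norm ?divr_gt0//; last by lra.
  rewrite -ler_pdivlMr ?divr_gt0//; last by lra.
  rewrite div1r invf_div opprD addrACA subrr addr0 -linearBl => le.
  rewrite -[X in X <= _]real_normK ?num_real// ler_sqr ?nnegrE//.
  by rewrite divr_ge0//; lra.
rewrite -ler_sqr ?nnegrE//; last by rewrite mulr_ge0 ?sqrtr_ge0// divr_ge0//; lra.
rewrite parseval exprMn sqr_sqrtr//.
apply: (@le_trans _ _ (\sum_(l < m) (2 * b / M.+1%:R) ^+ 2)).
  exact: ler_sum.
by rewrite sumr_const card_ord -[_ *+ m]mulr_natl ler_wpM2r ?sqr_ge0// ler_nat.
Qed.

End Inner.

(** * Decay of the energy *)

Section Residual.
Context {R : realType} {X : finDimBanachType R} (ip : {dot X for idfun})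
  (hip : is_inner_product ip).
Context (T : X -> X) (hT : nonexpansive T) (x0 y : X) (hy : y \in Fix T).
Context (lam : R -> R) (hlam : forall t : R, 0 <= t -> 0 <= lam t <= 1).
Context (x : R -> X) (hx : strong_global_solution lam T x0 x).

Let Ty : T y = y. Proof. by move: hy; rewrite inE. Qed.

Lemma solution0 : x 0 = x0. Proof. by case: hx. Qed.

Lemma fejer a b : 0 <= a <= b -> `|x b - y| <= `|x a - y|.
Proof.
move=> ab; have := dist_growth hT hlam hx y ab.
by rewrite /resid Ty subrr normr0 mul0r addr0.
Qed.

Lemma solution_lipschitz a b : 0 <= a <= b ->
  `|x b - x a| <= resid T x0 * (b - a).
Proof.
move=> ab; have := dist_growth hT hlam hx (x a) ab.
rewrite subrr normr0 add0r => /le_trans; apply; rewrite ler_wpM2r//.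
  by case/andP: ab; rewrite subr_ge0.
rewrite -solution0; apply: (resid_nonincreasing hT hlam hx).
by rewrite lexx; case/andP: ab.
Qed.

(** The trajectory is frozen at its initial value for negative times: this makes
    the energy continuous and nonincreasing on the whole line. *)
Definition energy (t : R) : R := `|x (Num.max 0 t) - y| ^+ 2.

Lemma energy_continuous : continuous energy.
Proof.
suff cg : continuous (fun t : R => `|x (Num.max 0 t) - y|).
  by move=> t; rewrite /energy; apply: cvgM; exact: cg.
have lip s t : s <= t -> `| `|x (Num.max 0 t) - y| - `|x (Num.max 0 s) - y| |
    <= resid T x0 * (t - s).
  move=> st; apply: (le_trans (ler_dist_dist _ _)); rewrite opprB addrA subrK.
  have st' : 0 <= Num.max 0 s <= Num.max 0 t.
    by rewrite le_max lexx/= ge_max !le_max lexx st orbT.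
  apply: (le_trans (solution_lipschitz st')); rewrite ler_wpM2l//.
    exact: normr_ge0.
  have : Num.max 0 t <= Num.max 0 s + (t - s).
    by rewrite !maxEle; case: ifP; case: ifP; lra.
  lra.
move=> t; apply/cvgrPdist_le => e e0.
have L0 : 0 < resid T x0 + 1 by rewrite ltr_wpDl// normr_ge0.
exists (e / (resid T x0 + 1)) => [|s /=]; first exact: divr_gt0.
rewrite ltr_pdivlMr// => /ltW te; apply: le_trans te.
have aux : resid T x0 * `|t - s| <= `|t - s| * (resid T x0 + 1).
  by rewrite mulrC ler_wpM2l// lerDl.
apply: le_trans aux; have [st|ts] := leP s t.
  by rewrite [in leRHS]ger0_norm ?subr_ge0//; exact: lip.
by rewrite distrC (distrC t) [in leRHS]gtr0_norm ?subr_gt0//; exact/lip/ltW.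
Qed.

Lemma energy_nonincreasing : {homo energy : u v /~ u <= v}.
Proof.
move=> v u uv; rewrite /energy ler_sqr ?nnegrE//; apply: fejer.
by rewrite le_max lexx/= ge_max !le_max lexx uv orbT.
Qed.

(** Up to an error [e1 * h], the vector [x (t + h) - y] is a relaxation step of
    size [h * lam t] from [A = x t - y] towards [D = T (x t) - y], and [|D| <= |A|].
    The bound of [sqr_norm_relax] differs from [|A|^2 - h * lam t * |D - A|^2]
    only by a term quadratic in [h]. *)
Lemma energy_slope (t e : R) : 0 <= t ->
  is_derive t 1 x (lam t *: (T (x t) - x t)) -> 0 < e ->
  exists2 c : R, 0 < c & forall h : R, 0 < h < c ->
    (lam t * resid T (x t) ^+ 2 - e) * h <= energy t - energy (t + h).
Proof.
move=> t0 dx e0; have /andP[l0 l1] := hlam t0.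
set A := x t - y; set D := T (x t) - y; set l := lam t in dx l0 l1 *.
have wE : T (x t) - x t = D - A by rewrite /D /A opprB addrA subrK.
have DA : `|D| <= `|A| by rewrite /D -{1}Ty; exact: hT.
set W := resid T (x t); have WE : `|D - A| = W by rewrite /W /resid wE.
(* The cross term [2 * e1 * |A|] below is then at most [e / 2]. *)
pose e1 := Num.min 1 (e / (4 * (`|A| + 1))).
have A0 : 0 <= `|A| by exact: normr_ge0.
have A1 : 0 < `|A| + 1 by rewrite ltr_wpDl.
have e10 : 0 < e1 by rewrite lt_min ltr01/= divr_gt0// mulr_gt0.
have e11 : e1 <= 1 by rewrite ge_min lexx.
have e1A : e1 * (`|A| + 1) <= e / 4.
  rewrite -ler_pdivlMr// -[leRHS]mulrA -invfM ge_min lexx orbT//.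
have [c c0 H] := is_derive_approx dx e10.
have W1 : 0 < W ^+ 2 + 1 by rewrite ltr_wpDl ?sqr_ge0.
exists (Num.min (Num.min c 1) (e / (2 * (W ^+ 2 + 1)))).
  by rewrite !lt_min c0 ltr01 divr_gt0// mulr_gt0.
move=> h; rewrite !lt_min => /andP[h0 /andP[/andP[hc h1] hW]].
have th0 : 0 <= t + h by rewrite addr_ge0// ltW.
rewrite /energy !max_r// -/A.
have {}H : `|x (t + h) - x t - h *: (l *: (D - A))| <= e1 * h.
  by have := H (t + h); rewrite addrAC subrr add0r gtr0_norm// wE => /(_ hc).
have k0 : 0 <= h * l by rewrite mulr_ge0// ltW.
have k1 : h * l <= 1 by rewrite mulr_ile1// ltW.
have N2 := sqr_norm_relax hip k0 DA.
have N1 : `|A + (h * l) *: (D - A)| <= `|A|.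
  by have := @norm_relax_le _ X A D (h * l) 0; rewrite k0 k1 mulr0 !addr0; exact.
set N := `|A + (h * l) *: (D - A)| in N1 N2.
have N0 : 0 <= N by exact: normr_ge0.
have xh : `|x (t + h) - y| <= N + e1 * h.
  have -> : x (t + h) - y = (A + (h * l) *: (D - A))
      + (x (t + h) - x t - h *: (l *: (D - A))).
    by rewrite scalerA addrACA subrr addr0 addrC addrA subrK.
  by rewrite (le_trans (ler_normD _ _))// lerD2l.
have eh0 : 0 <= e1 * h by rewrite mulr_ge0// ltW.
have xh2 : `|x (t + h) - y| ^+ 2 <= (N + e1 * h) ^+ 2.
  by rewrite ler_sqr ?nnegrE// addr_ge0.
rewrite WE in N2.
have hW2 : h * (W ^+ 2 + 1) <= e / 2.
  by move: hW; rewrite -ler_pdivlMr// -[leRHS]mulrA -invfM => /ltW.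
have i1 : h * (e1 * N) <= h * (e1 * `|A|) by rewrite ler_pM2l// ler_pM2l.
have i2 : h * (e1 * (`|A| + 1)) <= h * (e / 4) by rewrite ler_pM2l.
have i3 : e1 * h * (e1 * h) <= h * h by rewrite ler_pM// ler_piMl// ltW.
have i4 : (h * l) * (h * l) * W ^+ 2 <= h * h * W ^+ 2.
  by rewrite ler_wpM2r ?sqr_ge0// ler_pM// ler_piMr// ltW.
have i5 : h * (h * (W ^+ 2 + 1)) <= h * (e / 2) by rewrite ler_pM2l.
have i6 : 0 <= h * e1 by rewrite mulr_ge0// ltW.
clear H N1 xh; clearbody N W e1.
move: N2 xh2 i1 i2 i3 i4 i5 i6; rewrite sqrrD; lra.
Qed.

(** As [resid (x t) >= resid (x r)] for [t <= r], the energy decreases at rate at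
    least [resid (x r) ^+ 2 * k t] on [0, r]. *)
Lemma resid_integral (r K : R) (k : R -> R) : 0 <= r ->
  lebesgue_measurable_fun `[0, r] k ->
  (forall t, 0 <= t <= r -> 0 <= k t <= lam t) ->
  (K%:E <= \int[@completed_lebesgue_measure R]_(t in `[0%R, r]) (k t)%:E)%E ->
  resid T (x r) ^+ 2 * K <= `|x0 - y| ^+ 2.
Proof.
move=> r0 mk k01 Kle; set C := resid T (x r).
have mitvL : measurable (`[0, r]%classic : set (lebesgueTypeR R)).
  by apply: sub_caratheodory; exact: measurable_itv.
have C0 : 0 <= C by exact: normr_ge0.
rewrite -lee_fin EFinM.
apply: (@le_trans _ _ ((C ^+ 2)%:E *
   \int[@completed_lebesgue_measure R]_(t in `[0%R, r]) (k t)%:E)%E).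
  by rewrite lee_wpmul2l// lee_fin sqr_ge0.
have k0 t : `[0, r]%classic t -> (0 <= (k t)%:E)%E.
  by move=> /set_itvccP/k01/andP[]; rewrite lee_fin.
rewrite -(ge0_integralZl_EFin _ mitvL k0); last 2 first.
- exact/measurable_EFinP.
- exact: sqr_ge0.
rewrite (_ : `|x0 - y| ^+ 2 = energy 0); last by rewrite /energy maxxx solution0.
apply: (@integral_le_of_slope _ energy (fun t => C ^+ 2 * k t) r r0).
- exact: energy_continuous.
- by move=> t; exact: sqr_ge0.
- exact: energy_nonincreasing.
- by apply: measurable_funM; [exact: measurable_cst|exact: mk].
- by move=> t /k01/andP[kt _]; rewrite mulr_ge0 ?sqr_ge0.
have [_ _ [B [mB B0 notB]]] := hx; exists B; split => //.
apply: subset_trans notB; apply: subsetC => t /= dx /andP[t0 tr] e e0.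
have [c c0 H] := energy_slope t0 (dx t0) e0; exists c => // h hc.
apply: le_trans (H h hc); rewrite ler_wpM2r//; first by case/andP: hc => /ltW.
have Cle : C <= resid T (x t).
  by apply: (resid_nonincreasing hT hlam hx); rewrite t0.
have /k01/andP[kt0 ktl] : 0 <= t <= r by rewrite t0.
by rewrite lerD2r mulrC ler_pM ?sqr_ge0// ler_sqr ?nnegrE// (le_trans C0).
Qed.

End Residual.

(** * Rates of asymptotic regularity *)

Section Rates.
Context {R : realType} {X : finDimBanachType R} (ip : {dot X for idfun})
  (hip : is_inner_product ip).
Context (T : X -> X) (hT : nonexpansive T) (x0 y : X) (hy : y \in Fix T).
Context (lam : R -> R) (hlam : forall t : R, 0 <= t -> 0 <= lam t <= 1).
Context (x : R -> X) (hx : strong_global_solution lam T x0 x).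
Context (b : R) (b1 : 1 <= b) (hb : `|x0 - y| <= b).

Let b0 : 0 < b. Proof. exact: lt_le_trans b1. Qed.

Let sqr_hb : `|x0 - y| ^+ 2 <= b ^+ 2.
Proof. by rewrite ler_sqr ?nnegrE// ltW. Qed.

Lemma resid_divergence_rate (eta : R -> nat) (e : R) :
  lebesgue_measurable_fun `[0, +oo[ lam -> divergence_modulus lam eta ->
  0 < e -> resid T (x (eta (b ^+ 2 / e ^+ 2))%:R) <= e.
Proof.
move=> mlam [div _] e0; set r : R := _%:R.
have K0 : 0 < b ^+ 2 / e ^+ 2 by rewrite divr_gt0// exprn_gt0.
have mS : lebesgue_measurable_fun `[0, r] lam.
  have mitvL : measurable (`[0, +oo[%classic : set (lebesgueTypeR R)).
    by apply: sub_caratheodory; exact: measurable_itv.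
  apply: (measurable_funS mitvL _ mlam).
  by move=> t /set_itvccP/andP[t0 _]; rewrite /= in_itv/= t0.
have mk : lebesgue_measurable_fun `[0, r] (fun t => lam t * (1 - lam t)).
  apply: measurable_funM; first exact: mS.
  by apply: measurable_funB; [exact: measurable_cst|exact: mS].
have := resid_integral hip hT hy hlam hx (ler0n R _) mk _ (div _ _ K0 (lexx r)).
have k01 t : 0 <= t <= r -> 0 <= lam t * (1 - lam t) <= lam t.
  move=> /andP[/hlam/andP[l0 l1] _].
  by rewrite mulr_ge0 ?subr_ge0// ler_piMr// gerBl.
move=> /(_ k01) /le_trans/(_ sqr_hb).
rewrite mulrA -mulrAC ger_pMl ?exprn_gt0// ler_pdivrMr ?exprn_gt0// mul1r.
by rewrite ler_sqr// nnegrE ?normr_ge0// ltW.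
Qed.

(** The argument gives the rate [b^2 / (laml * e^2)]; the one stated is larger
    because [b >= 1] and [laml <= 1]. *)
Lemma resid_lower_bound_rate (laml e : R) :
  0 < laml -> (forall t, 0 <= t -> laml <= lam t) -> 0 < e ->
  resid T (x (4 * b ^+ 4 / (laml ^+ 2 * e ^+ 2))) <= e.
Proof.
move=> laml0 lamge e0; set r : R := _ / _.
have r0 : 0 < r by rewrite divr_gt0// mulr_gt0// ?exprn_gt0.
have laml1 : laml <= 1.
  by apply: (le_trans (lamge 0 (lexx 0))); case/andP: (hlam (lexx 0)).
have mk : lebesgue_measurable_fun `[0, r] (fun=> laml) by exact: measurable_cst.
have k01 t : 0 <= t <= r -> 0 <= laml <= lam t.
  by move=> /andP[t0 _]; rewrite (ltW laml0) lamge.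
have := resid_integral (K := laml * r) hip hT hy hlam hx (ltW r0) mk k01.
rewrite ge0_integral_completed; last 3 first.
- exact: measurable_itv.
- exact: measurable_cst.
- by move=> t _; rewrite lee_fin ltW.
rewrite integral_cst; last exact: measurable_itv.
have muE : lebesgue_measure (`[0, r]%classic : set R) = r%:E.
  by rewrite lebesgue_measure_itv/= lte_fin r0 sube0.
rewrite [X in (_ * X)%E](_ : _ = r%:E); last exact: muE.
rewrite -EFinM lexx => /(_ isT) /le_trans/(_ sqr_hb); set C := resid _ _.
have -> : laml * r = 4 * b ^+ 4 / (laml * e ^+ 2).
  by rewrite /r; field; rewrite !gt_eqF.
have le0 : 0 < laml * e ^+ 2 by rewrite mulr_gt0// exprn_gt0.
rewrite mulrA ler_pdivrMr// (_ : C ^+ 2 * _ = b ^+ 2 * (C ^+ 2 * (4 * b ^+ 2))).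
  rewrite ler_pM2l ?exprn_gt0// => Cle.
  suff : C ^+ 2 <= e ^+ 2 by rewrite ler_sqr// nnegrE ?normr_ge0// ltW.
  apply: (@le_trans _ _ (C ^+ 2 * (4 * b ^+ 2))).
    by rewrite ler_peMr ?sqr_ge0//; have := exprn_ege1 2 b1; lra.
  by apply: (le_trans Cle); rewrite ler_piMl// sqr_ge0.
by ring.
Qed.

End Rates.

(** * The explicit bounds *)

Section Bounds.
Context {R : realType}.

Lemma delta_hat_gt0 (b : nat) (f : nat -> nat) (delta : R) D j :
  (0 < b)%N -> 0 < delta -> 0 < delta_hat b f delta D j.
Proof.
move=> b0 d0; have d2 : 0 < delta / 2 by rewrite divr_gt0.
apply: lt_bigmin => // i _; apply: lt_bigmin => // m _.
by rewrite divr_gt0 ?divr_gt0 ?exprn_gt0// mulr_gt0 ?mulr_gt0 ?ltr0n//.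
Qed.

Lemma delta_hat_le_half (b : nat) (f : nat -> nat) (delta : R) D j :
  delta_hat b f delta D j <= delta / 2.
Proof. exact: bigmin_le_id. Qed.

(** The largest [m] admitted in the minimum for the index [i] is the one which
    produces the integer [m + 1] following [D i]. *)
Lemma delta_hat_le (b : nat) (f : nat -> nat) (delta : R) D i j :
  (i < j)%N -> 0 <= D i ->
  delta_hat b f delta D j <=
    delta ^+ 2 / 12 / (4 * b%:R * ((f (Num.truncn (D i)).+1)%:R + 1)).
Proof.
move=> ij Di; apply: (bigmin_inf (Ordinal ij)) => //.
apply: (bigmin_inf ord_max) => //=.
by case/andP: (truncn_itv Di).
Qed.

Lemma Delta_step_le_Delta phi b f d (delta : R) i :
  (i <= cover_bound b d delta)%N ->
  Delta_step phi b f i delta + 1 <= Delta phi b f d delta.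
Proof.
move=> iP; rewrite lerD2r.
exact: (le_bigmax _ (fun i : 'I__ => Delta_step phi b f i delta) (Ordinal (_ : i < _.+1)%N)).
Qed.

Lemma Delta_ge0 phi b f d (delta : R) : 0 <= Delta phi b f d delta.
Proof. by rewrite addr_ge0// bigmax_ge_id. Qed.

(** When the base of the power in [cover_bound] vanishes (dimension 0), a
    single cell is used instead: the final [+ 1] still leaves more points than
    cells. *)
Lemma cover_bound_mesh (b d : nat) (delta : R) : (0 < b)%N -> 0 < delta ->
  exists2 M : nat, (M.+1 ^ d < (cover_bound b d delta).+1)%N
    & Num.sqrt d%:R * (2 * b%:R / M.+1%:R) <= delta / Num.sqrt 12.
Proof.
move=> b0 d0; rewrite /cover_bound.
set q : R := _%:~R; set Y : R := _ * b%:R; set M := `|_|%N.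
(* [M.-1.+1] is [M], except that it is 1 when [M] vanishes. *)
exists M.-1; first by case: M => [|M]; rewrite ?exp1n !addn1 ?ltnS// leqnSn.
have s12 : 0 < Num.sqrt 12 :> R by rewrite sqrtr_gt0.
have qge : Num.sqrt 12 / delta <= q by exact: ceil_ge.
have q0 : 0 < q by apply: lt_le_trans qge; rewrite divr_gt0.
have [d_eq0|d_gt0] := posnP d.
  by rewrite d_eq0 sqrtr0 mul0r divr_ge0 ?sqrtr_ge0// ltW.
have sd : 0 < Num.sqrt d%:R :> R by rewrite sqrtr_gt0 ltr0n.
have Y0 : 0 < Y by rewrite /Y !mulr_gt0 ?ltr0n// addr_gt0.
have MY : Y <= M%:R.
  by rewrite natr_absz (le_trans (ceil_ge Y))// ler_int ler_norm.
have M0 : 0 < M%:R :> R by exact: lt_le_trans MY.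
rewrite prednK; last by rewrite -(ltr0n R).
rewrite mulrA ler_pdivrMr//; apply: le_trans (_ : delta / Num.sqrt 12 * Y <= _).
  rewrite /Y (_ : _ / _ * _ = Num.sqrt d%:R * (2 * b%:R)
    * (delta / Num.sqrt 12 * (q + 1))); last by ring.
  rewrite ler_peMr//.
  rewrite -ler_pdivrMl ?divr_gt0// mulr1 invf_div.
  by rewrite (le_trans qge)// lerDl.
by rewrite ler_wpM2l// divr_ge0// ltW.
Qed.

End Bounds.

(** * Metastability *)

Section Metastability.
Context {R : realType} {X : finDimBanachType R} (ip : {dot X for idfun})
  (hip : is_inner_product ip).
Context (T : X -> X) (hT : nonexpansive T) (x0 y : X) (hy : y \in Fix T).
Context (lam : R -> R) (hlam : forall t : R, 0 <= t -> 0 <= lam t <= 1).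
Context (x : R -> X) (hx : strong_global_solution lam T x0 x).
Context (b : nat) (hb : `|x0 - y| <= b%:R).

Lemma dist_fix_le t : 0 <= t -> `|x t - y| <= b%:R.
Proof.
move=> t0; apply: le_trans hb; rewrite -[in leRHS](solution0 hx).
by apply: (fejer hT hy hlam hx); rewrite lexx.
Qed.

Lemma resid_le_dist_fix z : resid T z <= 2 * `|z - y|.
Proof.
have Ty : T y = y by move: hy; rewrite inE.
have := resid_lip hT y z; rewrite /resid Ty subrr normr0 subr0.
by rewrite ger0_norm.
Qed.

(** The trajectory drifts away from [p] by at most [resid p * c] during a time
    [c], and the residual is 2-Lipschitz. *)
Lemma near_almost_fixed p tau c delta t : 0 <= tau -> tau <= t ->
  t - tau <= c -> `|x tau - p| <= delta / 3 -> resid T p <= delta / 2 ->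
  resid T p * c <= delta / 6 ->
  `|x t - p| <= delta / 2 /\ resid T (x t) <= 3 / 2 * delta.
Proof.
move=> tau0 taut tc xp rp rpc.
have r0 : 0 <= resid T p by exact: normr_ge0.
have h1 : `|x t - p| <= delta / 2.
  have := dist_growth hT hlam hx p (a := tau) (b := t).
  rewrite tau0 taut => /(_ isT); have := ler_wpM2l r0 tc; lra.
split=> //; have := le_trans (ler_norm _) (resid_lip hT p (x t)); lra.
Qed.

Context (phi : R -> R) (f : nat -> nat).
Context (rate : forall e, 0 < e -> 0 <= phi e /\ resid T (x (phi e)) <= e).

(** The bound [delta <= b] turns the tuned residual, which is at most
    [delta ^+ 2 / (48 b (f n + 1))], into a drift of at most [delta / 48] during the
    time [f n + 1]. *)
Lemma metastable delta : (0 < b)%N -> 0 < delta -> delta <= b%:R ->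
  exists n : nat, n%:R <= Delta phi b f (\dim {:X}) delta /\
    exists p : X, forall t, n%:R <= t <= n%:R + (f n)%:R ->
      `|x t - p| <= delta / 2 /\ resid T (x t) <= 3 / 2 * delta.
Proof.
move=> b0 d0 db; have b0' : 0 < b%:R :> R by rewrite ltr0n.
pose tau i := Delta_step phi b f i delta.
have tauE i : (0 < i)%N -> tau i = phi (delta_hat b f delta tau i).
  exact: Delta_stepE.
have dhat0 i : 0 < delta_hat b f delta tau i by exact: delta_hat_gt0.
have tau0 i : 0 <= tau i.
  case: i => [|i]; first by rewrite /tau Delta_step0.
  by rewrite tauE//; case: (rate (dhat0 i.+1)).
have [M Mn mesh] := cover_bound_mesh (\dim {:X}) b0 d0.
pose z (i : 'I_(cover_bound b (\dim {:X}) delta).+1) := x (tau i) - y.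
have zb i : `|z i| <= b%:R by exact: dist_fix_le.
have [i [j [ij]]] := ball_pigeonhole hip b0' Mn zb.
rewrite /z opprB addrA subrK => /le_trans/(_ mesh) close.
have s3 : 3 <= Num.sqrt 12 :> R.
  by rewrite -(@ger0_norm _ (3 : R))// -sqrtr_sqr ler_wsqrtr//; lra.
have close3 : `|x (tau i) - x (tau j)| <= delta / 3.
  by apply: (le_trans close); rewrite ler_pM2l// lef_pV2// posrE; lra.
pose n := (Num.truncn (tau i)).+1.
have /andP[ti tn] := truncn_itv (tau0 i).
exists n; split.
  have iP : (i <= cover_bound b (\dim {:X}) delta)%N by rewrite -ltnS.
  by apply: le_trans (Delta_step_le_Delta phi f iP); rewrite -natr1 lerD2r.
exists (x (tau j)) => t /andP[nt tnf].
have rj : resid T (x (tau j)) <= delta_hat b f delta tau j.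
  by rewrite [tau j]tauE ?(leq_ltn_trans _ ij)//; case: (rate (dhat0 j)).
have fn0 : 0 < (f n)%:R + 1 :> R by rewrite ltr_wpDl.
apply: (@near_almost_fixed _ (tau i) ((f n)%:R + 1)) => //.
- by apply: ltW (lt_le_trans tn nt).
- have : n%:R = (Num.truncn (tau i))%:R + 1 :> R by rewrite natr1.
  lra.
- exact: le_trans rj (delta_hat_le_half _ _ _ _ _).
have := le_trans rj (delta_hat_le b f delta ij (tau0 i)); rewrite -/n.
rewrite ler_pdivlMr ?mulr_gt0// => h.
have h2 : delta * delta <= delta * b%:R by rewrite ler_pM2l.
have h3 : 0 < delta * b%:R by rewrite mulr_gt0.
rewrite -(ler_pM2l b0'); move: h h2 h3; rewrite expr2; lra.
Qed.

End Metastability.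

Theorem theorem4p6 (R : realType) (d : nat)
    (X : finDimBanachType R) (ip : {dot X for idfun})
    (hip : is_inner_product ip) (hd : \dim {:X} = d)
    (T : X -> X) (hT : nonexpansive T)
    (x0 y : X) (hy : y \in Fix T)
    (b : nat) (hb : `|x0 - y| <= b%:R)
    (lam : R -> R)
    (hlam01 : forall t, 0 <= t -> 0 <= lam t <= 1)
    (hlam : lebesgue_measurable_fun `[0, +oo[ lam)
    (x : R -> X) (hx : strong_global_solution lam T x0 x)
    (phi : R -> R)
    (hphi :
       (exists eta : R -> nat,
          [/\ (\int[@completed_lebesgue_measure R]_(t in `[0%R, +oo[)
                 (lam t * (1 - lam t))%:E = +oo)%E,
              divergence_modulus lam eta
            & forall e, 0 < e -> phi e = (eta (b%:R ^+ 2 / e ^+ 2))%:R])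
       \/
       (exists laml : R,
          [/\ 0 < inf [set lam t | t in `[0, +oo[],
              0 < laml,
              (forall t, 0 <= t -> laml <= lam t)
            & forall e, 0 < e ->
                phi e = 4 * b%:R ^+ 4 / (laml ^+ 2 * e ^+ 2)])) :
  forall (eps : R) (f : nat -> nat), 0 < eps ->
    exists n : nat,
      n%:R <= Delta phi b f d (eps / 4) /\
      forall s t : R,
        s \in `[n%:R, n%:R + (f n)%:R] -> t \in `[n%:R, n%:R + (f n)%:R] ->
        `|x s - x t| <= eps /\ `|x t - T (x t)| <= eps.
Proof.
move=> eps f eps0.
have [b_le|lt_b] := leP (2 * b%:R) eps.
  exists 0; split=> [|s t]; first exact: Delta_ge0.
  rewrite !in_itv/= => /andP[s0 _] /andP[t0 _].
  have ds := dist_fix_le hT hy hlam01 hx hb s0.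
  have dt := dist_fix_le hT hy hlam01 hx hb t0.
  split; last by rewrite distrC; have := resid_le_dist_fix hT hy (x t); rewrite /resid; lra.
  by have := ler_distD y (x s) (x t); rewrite (distrC y); lra.
have b0 : (0 < b)%N by rewrite -(ltr0n R); lra.
have b1 : 1 <= b%:R :> R by rewrite ler1n.
have rate e : 0 < e -> 0 <= phi e /\ resid T (x (phi e)) <= e.
  move=> e0; case: hphi => [[eta [_ div phiE]]|[laml [_ laml0 lamge phiE]]].
    rewrite phiE//; split=> //.
    exact: (resid_divergence_rate hip hT hy hlam01 hx b1 hb hlam div e0).
  rewrite phiE//; split.
    by rewrite divr_ge0 ?mulr_ge0 ?exprn_ge0// ltW.
  exact: (resid_lower_bound_rate hip hT hy hlam01 hx b1 hb laml0 lamge e0).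
have eps4 : 0 < eps / 4 by rewrite divr_gt0.
have eps4b : eps / 4 <= b%:R by lra.
have [n [nD [p near_p]]] :=
  metastable hip hT hy hlam01 hx hb f rate b0 eps4 eps4b.
exists n; split=> [|s t]; first by rewrite -hd.
rewrite !in_itv/= => /near_p[sp _] /near_p[tp rt]; split.
  by have := ler_distD p (x s) (x t); rewrite (distrC p); lra.
by rewrite distrC; move: rt; rewrite /resid; lra.
Qed.
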